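(* If $X$ is a homogeneous compact suspension, then $X$ is an absolute suspension (i.e., for any two distinct points $p$ and $q$ of $X$, there is a homeomorphism from $X$ to a suspension that maps $p$ and $q$ to the suspension points).
   Context: A space $X$ is homogeneous if for any two points $p$ and $q$ of $X$ there is a homeomorphism of $X$ (onto itself) that maps $p$ to $q$. The suspension of a space $Y$ is the quotient of $Y \times [-1,1]$ obtained by collapsing $Y \times \{-1\}$ to one point and $Y \times \{1\}$ to another point; these two points are called the suspension points. ''A suspension'' means the suspension of some space $Y$. A compact space $X$ is an absolute suspension if for any two distinct points $p$ and $q$ of $X$ there is a homeomorphism from $X$ to a suspension that maps $p$ and $q$ to the suspension points. *)

(* Defs.v *)
From HB Require Import structures.
From mathcomp Require Import all_boot all_order all_algebra generic_quotient.
From mathcomp Require Import all_classical all_reals all_analysis.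
Import Order.TTheory GRing.Theory Num.Theory numFieldNormedType.Exports.

Set Implicit Arguments.
Unset Strict Implicit.
Unset Printing Implicit Defensive.

Local Open Scope classical_set_scope.
Local Open Scope ring_scope.
Local Open Scope quotient_scope.

Definition homeomorphism (X Y : topologicalType) (f : X -> Y) : Prop :=
  continuous f /\
  exists g : Y -> X, [/\ continuous g, cancel f g & cancel g f].

Definition homogeneous (X : topologicalType) : Prop :=
  forall p q : X, exists f : X -> X, homeomorphism f /\ f p = q.

Section Suspension.
Variables (R : realType) (Y : topologicalType).

(* [set_type A] carries the subspace topology, and [*] the product topology. *)
Definition cylinder : topologicalType := (Y * set_type `[(-1 : R), 1])%type.

Definition height (z : cylinder) : R := set_val z.2.

(* Distinct points are identified exactly when they both lie on the bottom
   Y x {-1} or both lie on the top Y x {1}. *)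
Definition suspension_rel (z w : cylinder) : bool :=
  [|| z == w, (height z == -1) && (height w == -1) |
      (height z == 1) && (height w == 1)].

Lemma suspension_rel_refl : reflexive suspension_rel.
Proof. by move=> z; rewrite /suspension_rel eqxx. Qed.

Lemma suspension_rel_sym : symmetric suspension_rel.
Proof.
by move=> z w; rewrite /suspension_rel eq_sym andbC [X in _ || (_ || X)]andbC.
Qed.

Lemma suspension_rel_trans : transitive suspension_rel.
Proof.
have N11 : (-1 == 1 :> R) = false by apply/negbTE; rewrite lt_eqF// gtrN.
move=> w z v; rewrite /suspension_rel.
case/or3P => [/eqP-> //|/andP[/eqP -> /eqP wE]|/andP[/eqP -> /eqP wE]];
  case/or3P => [/eqP <-|/andP[+ /eqP ->]|/andP[+ /eqP ->]];
  by rewrite wE ?eqxx ?orbT // ?[1 == -1]eq_sym ?N11.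
Qed.

Canonical suspension_equiv := EquivRel suspension_rel
  suspension_rel_refl suspension_rel_sym suspension_rel_trans.

Definition suspension : topologicalType :=
  quotient_topology {eq_quot suspension_equiv}.

Definition suspension_proj (z : cylinder) : suspension :=
  \pi_{eq_quot suspension_equiv} z.

(* The images of Y x {-1} and Y x {1}: two points, unless Y is empty, in which
   case the quotient of Y x [-1, 1] is empty as well. *)
Definition suspension_points : set suspension :=
  suspension_proj @` [set z | height z = -1 \/ height z = 1].

End Suspension.

Arguments suspension_points : clear implicits.

Definition is_suspension (R : realType) (X : topologicalType) : Prop :=
  exists (Y : topologicalType) (f : X -> suspension R Y), homeomorphism f.

Definition absolute_suspension (R : realType) (X : topologicalType) : Prop :=
  compact [set: X] /\
  forall p q : X, p <> q ->
    exists (Y : topologicalType) (f : X -> suspension R Y),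
      homeomorphism f /\ f @` [set p; q] = suspension_points R Y.

(* Main.v *)
Require Import Defs.
From mathcomp Require Import all_boot all_order all_algebra.
From mathcomp Require Import all_classical all_reals all_analysis.
From mathcomp Require Import ring lra generic_quotient.
Import Order.TTheory GRing.Theory Num.Theory numFieldNormedType.Exports.

Set Implicit Arguments.
Unset Strict Implicit.
Unset Printing Implicit Defensive.

(** Let [X] be the suspension of [Y].  Call [q] and [p] antipodal when some
homeomorphism of [X] carries them to the bottom and to the top suspension
point; the aim is that any two distinct points are antipodal
([antipodal_all]).  The height separates the bottom from every other point, so
a homogeneous suspension is Hausdorff
([homogeneous_suspension_hausdorff]).

The main tool is a swindle ([swindle]).  Let [A] and [B] be two suspension
structures on [X], from [p'] to [p] and from [r] to [r'].  Suppose that a ball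
[V = {A <= t0}] around [p'] contains [r] but not [r'], and that a ball
[W = {B <= u0}] around [r] contains [p'] but not [p].  Let [alpha] be the
layer between a small [A]-ball inside [W] and [W], and [beta] the layer
between [W] and a large [A]-ball.  Stacking [alpha] and [beta] gives a layer
between two [A]-balls, which is a product.  As [V] lies between two [B]-balls,
and as the radius of a ball is irrelevant, [beta] is also the layer between a
small [B]-ball and [V], and [alpha] the one between [V] and a large [B]-ball;
hence stacking [beta] and [alpha] gives a product as well.  Now the complement
of [W] in [X] minus [r'] is the infinite stack of layers [beta alpha], while
its complement in [X] minus [p] is [beta (alpha beta) (alpha beta) ...], that
is the same stack bracketed differently.  So some homeomorphism of [X] fixes
[r] and carries [r'] to [p]; as [r] and [r'] are antipodal, so are [r] and [p].

It remains to place balls as the swindle requires, for [q] and the top [s].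
Choose [q'] antipodal to [q].  If [q'] is a suspension point, at most a flip
of [X] is needed ([antipodal_bot_top]).  If [q'] is not on the ray of [q], then sliding
[q] along its ray, with [q'] fixed, makes the height of [q] smaller than that
of [q'] ([move_along_ray]).  The other condition compares the two suspension
points in the structure from [q] to [q'], and can be achieved by a flip of [X]
([antipodal_top]).  Finally, some [q'] does lie off the ray of [q]
([antipodal_off_ray]): if all points antipodal to [q] were on that ray, then
for any two of them, [x] and [y], the image of a ray of the structure from [q]
to [x] would show that [y] is strictly between [q] and [x], and symmetrically
[x] would be strictly between [q] and [y].  There are two such points because
otherwise the antipode would be a function commuting with all homeomorphisms,
yet a point can be slid while its antipode stays in place
([antipodal_two]). *)

Local Open Scope classical_set_scope.
Local Open Scope ring_scope.
Local Open Scope quotient_scope.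

(** * Homeomorphisms of compact Hausdorff spaces *)

Section Homeomorphisms.
Variables (X Y Z : topologicalType).

Lemma homeomorphism_comp (f : X -> Y) (g : Y -> Z) :
  homeomorphism f -> homeomorphism g -> homeomorphism (g \o f).
Proof.
move=> [cf [f' [cf' fK f'K]]] [cg [g' [cg' gK g'K]]]; split.
  by move=> x; apply: continuous_comp; [exact: cf|exact: cg].
exists (f' \o g'); split; last 2 first.
- exact: can_comp gK fK.
- exact: can_comp f'K g'K.
by move=> x; apply: continuous_comp; [exact: cg'|exact: cf'].
Qed.

Lemma homeomorphism_inv (f : X -> Y) : homeomorphism f ->
  exists g : Y -> X, [/\ homeomorphism g, cancel f g & cancel g f].
Proof.
move=> [cf [g [cg fK gK]]]; exists g; split=> //.
by split=> //; exists f; split.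
Qed.

Lemma homeomorphism_inj (f : X -> Y) : homeomorphism f -> injective f.
Proof. by move=> [_ [g [_ fK _]]]; exact: can_inj fK. Qed.

Lemma compact_hausdorff_homeomorphism (f : X -> Y) :
  compact [set: X] -> hausdorff_space Y -> continuous f ->
  injective f -> (forall y, exists x, f x = y) -> homeomorphism f.
Proof.
move=> cX hY cf finj /choice[g gK].
have fK : cancel f g by move=> x; apply: finj; rewrite gK.
split=> //; exists g; split=> //; apply/continuous_closedP => A cA.
have -> : g @^-1` A = f @` A.
  apply/seteqP; split=> [y /= Ag|y [x Ax <-] /=]; last by rewrite fK.
  by exists (g y).
apply: compact_closed => //; apply: continuous_compact.
  exact: continuous_subspaceT.
exact: (subclosed_compact cA cX (@subsetT _ _)).
Qed.

End Homeomorphisms.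

Lemma homeomorphism_id (X : topologicalType) : homeomorphism (@id X).
Proof.
by split; [move=> x; exact: cvg_id|exists id; split=> // x; exact: cvg_id].
Qed.

Lemma iter_homeomorphism (X : topologicalType) (f : X -> X) n :
  homeomorphism f -> homeomorphism (iter n f).
Proof.
move=> hf; elim: n => [|n IH]; first exact: homeomorphism_id.
exact: homeomorphism_comp IH hf.
Qed.

(** Two homeomorphisms that send [C] onto the same set [C'] also send its
complement onto the same set, which is why following one inside [C] and the
other outside stays bijective. *)
Lemma homeomorphism_glue (X : topologicalType) (C D C' : set X)
    (f g : X -> X) :
  compact [set: X] -> hausdorff_space X -> closed C -> closed D ->
  (forall x, C x \/ D x) -> (forall x, C x -> D x -> f x = g x) ->
  homeomorphism f -> homeomorphism g ->
  (forall x, C x <-> C' (f x)) -> (forall x, C x <-> C' (g x)) ->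
  homeomorphism (fun x => if `[< C x >] then f x else g x).
Proof.
move=> cX hX cC cD CD fg hf hg fC gC.
have [cf _] := hf; have [cg _] := hg.
set h := fun x => _.
have hC x : C x -> h x = f x by move=> Cx; rewrite /h asboolT.
have hD x : D x -> h x = g x.
  by move=> Dx; rewrite /h; case: asboolP => // Cx; exact: fg.
have hC' x : C x <-> C' (h x).
  by rewrite /h; case: asboolP => Cx; [exact: fC|exact: gC].
have hNC x : ~ C x -> h x = g x by move=> Cx; rewrite /h asboolF.
apply: compact_hausdorff_homeomorphism => //.
- apply/continuous_closedP => A cA.
  have -> : h @^-1` A = (C `&` f @^-1` A) `|` (D `&` g @^-1` A).
    apply/seteqP; split=> x /=.
      case: (CD x) => [Cx|Dx]; first by rewrite hC//; left.
      by rewrite hD//; right.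
    by move=> [[Cx]|[Dx]]; [rewrite hC|rewrite hD].
  move/continuous_closedP : cf => /(_ A cA) cfA.
  move/continuous_closedP : cg => /(_ A cA) cgA.
  by apply: closedU; exact: closedI.
- move=> x y e; have [Cx|Cx] := EM (C x).
    have Cy : C y by apply/hC'; rewrite -e; apply/hC'.
    by apply: (homeomorphism_inj hf); rewrite -!hC.
  have Cy : ~ C y by move=> Cy; apply: Cx; apply/hC'; rewrite e; apply/hC'.
  by apply: (homeomorphism_inj hg); rewrite -!hNC.
- move=> z; have [C'z|C'z] := EM (C' z).
    have [f' [_ _ f'K]] := homeomorphism_inv hf.
    exists (f' z); rewrite hC ?f'K//; apply/fC; rewrite f'K//.
  have [g' [_ _ g'K]] := homeomorphism_inv hg.
  exists (g' z); rewrite hNC ?g'K// => Cz; apply: C'z.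
  by rewrite -(g'K z); apply/gC.
Qed.

(** Compactness lets a closed set avoid a whole neighbourhood of the bottom
level, not only the bottom itself. *)
Lemma compact_above_level (R : realType) (X : topologicalType) (h : X -> R)
    (C : set X) (m M : R) : compact [set: X] -> continuous h -> closed C ->
  (forall x, C x -> m < h x) -> m < M ->
  exists l, [/\ m < l, l < M & forall x, C x -> l < h x].
Proof.
move=> cX ch cC hC mM.
have [[x0 Cx0]|C0] := EM (C !=set0); last first.
  by exists ((m + M) / 2); split; [lra|lra|move=> x Cx; case: C0; exists x].
have cptC : compact C by exact: (subclosed_compact cC cX (@subsetT _ _)).
have [||c Cc minc] := @compact_EVT_min _ _ h C _ cptC.
- by exists x0.
- exact: continuous_subspaceT.
have mc : m < h c by apply: hC; exact: set_mem.
pose k := Num.min (h c) M.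
have mk : m < k by rewrite lt_min mc.
have kM : k <= M by rewrite ge_min lexx orbT.
exists ((m + k) / 2); split; [lra|lra|].
move=> x Cx; have := minc x (mem_set Cx).
have : k <= h c by rewrite ge_min lexx.
by lra.
Qed.

Lemma compact_below_level (R : realType) (X : topologicalType) (h : X -> R)
    (C : set X) (m M : R) : compact [set: X] -> continuous h -> closed C ->
  (forall x, C x -> h x < M) -> m < M ->
  exists l, [/\ m < l, l < M & forall x, C x -> h x < l].
Proof.
move=> cX ch cC hC mM.
have cN : continuous (fun x => - h x).
  by move=> x; exact: (@continuousN _ _ _ h x (ch x)).
have hN x : C x -> - M < - h x by move=> Cx; rewrite ltrN2; exact: hC.
have mMN : - M < - m by rewrite ltrN2.
have [l [l1 l2 hl]] := compact_above_level cX cN cC hN mMN.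
by exists (- l); split; [lra|lra|move=> x /hl; lra].
Qed.

(** * Periodic extension of a homeomorphism *)

(** [D] minus [U] is a fundamental layer for [etai], whose inverse pushes [D]
towards [r'], and [rho] pushes [E] towards [p].  The map [w] sends [U] onto
[E] and [D] onto [rho E], so it sends the fundamental layer of [etai] onto the
one of [rho], and [wglue] says that its values on the two ends of the layer
differ by [rho].  So [w] extends to the layers further out by conjugating it
with powers of [etai] and [rho]. *)
Section Telescope.
Variables (X : topologicalType) (U D D' E : set X) (p r' : X).
Variables (w rho rhoi etai : X -> X).
Hypotheses (cX : compact [set: X]) (hX : hausdorff_space X).
Hypotheses (hw : homeomorphism w) (hrho : homeomorphism rho)
  (hetai : homeomorphism etai).
Hypothesis rhoK : cancel rho rhoi.
Hypotheses (cD : closed D) (cD' : closed D') (DD' : forall x, D x \/ D' x).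
Hypotheses (UD : U `<=` D) (DU : forall x, D x <-> U (etai x)).
Hypotheses (wU : forall x, U x <-> E (w x))
  (wD : forall x, D x <-> E (rhoi (w x))).
Hypothesis wglue : forall x, D x -> D' x -> w x = rho (w (etai x)).
Hypotheses (rhop : rho p = p) (Np : ~ E p)
  (rho_shrink : forall N, nbhs p N ->
     exists j, forall z, ~ E (iter j rhoi z) -> N z).
Hypotheses (etar' : etai r' = r') (Nr' : ~ D r')
  (eta_exhaust : forall x, x <> r' ->
     exists j, \forall y \near x, D (iter j etai y)).

(** The extension of [w] over the first [k] layers beyond [D]; it remains a
homeomorphism of the whole space. *)
Fixpoint telescope_stage (k : nat) (x : X) : X :=
  if k is k'.+1 then
    if `[< D x >] then w x else rho (telescope_stage k' (etai x))
  else w x.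
Local Notation stage := telescope_stage.

Let stage_D k x : D x -> stage k x = w x.
Proof. by case: k => //= k Dx; rewrite asboolT. Qed.

Let stage_ND k x : ~ D x -> stage k.+1 x = rho (stage k (etai x)).
Proof. by move=> Dx /=; rewrite asboolF. Qed.

Let rhoiE z : E z -> E (rhoi z).
Proof.
have [w' [_ _ w'K]] := homeomorphism_inv hw.
by rewrite -(w'K z) => /wU/UD/wD.
Qed.

Let stage_rhoE k x : E (rhoi (stage k x)) <-> D x.
Proof.
elim: k x => [|k IH] x; first by symmetry; exact: wD.
have [Dx|Dx] := EM (D x); first by rewrite stage_D//; symmetry; exact: wD.
rewrite stage_ND// rhoK; split=> // Ek; exfalso; apply: Dx; apply/DU.
have Dex : D (etai x) by apply/(IH (etai x)); exact: rhoiE.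
by move: Ek; rewrite stage_D// => /wU.
Qed.

Let stage_E k x : E (stage k x) <-> U x.
Proof.
split=> [Ek|Ux]; last by rewrite stage_D; [apply/wU|exact: UD].
have Dx : D x by apply/(stage_rhoE k); exact: rhoiE.
by move: Ek; rewrite stage_D// => /wU.
Qed.

Let etaiD x : D x -> D (etai x).
Proof. by move=> /DU/UD. Qed.

Let homeomorphism_stage k : homeomorphism (stage k).
Proof.
elim: k => [//|k IH].
apply: (homeomorphism_glue (C' := fun z => E (rhoi z))
  (g := rho \o stage k \o etai) cX hX cD cD' DD').
- move=> x Dx D'x /=; rewrite wglue// stage_D//; exact: etaiD.
- exact: hw.
- exact: homeomorphism_comp hetai (homeomorphism_comp IH hrho).
- exact: wD.
- by move=> x /=; rewrite rhoK; split => [/DU|] /stage_E // /DU.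
Qed.

Let stage_stable j k x : D (iter j etai x) -> (j <= k)%N ->
  stage k x = stage j x.
Proof.
elim: j k x => [|j IH] [|k] x //; first by move=> Dx _; rewrite !stage_D.
rewrite iterSr ltnS => Dj jk; have [Dx|Dx] := EM (D x).
  by rewrite !stage_D.
by rewrite !stage_ND// (IH k).
Qed.

Let iter_rhoiE j z : E z -> E (iter j rhoi z).
Proof. by elim: j => //= j IH /IH; exact: rhoiE. Qed.

Let stage_iterE j k x : (j <= k)%N ->
  E (iter j.+1 rhoi (stage k x)) <-> D (iter j etai x).
Proof.
elim: j k x => [|j IH] [|k] x //; try by move=> _; exact: stage_rhoE.
rewrite ltnS => jk; have [Dx|Dx] := EM (D x).
  split=> _; first by elim: (j.+1) => //= i; exact: etaiD.
  rewrite iterSr; apply: iter_rhoiE; exact/stage_rhoE.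
by rewrite iterSr stage_ND// rhoK [iter _ etai x]iterSr; exact: IH.
Qed.

Let iter_fix (f : X -> X) x j : f x = x -> iter j f x = x.
Proof. by move=> fx; elim: j => //= j ->. Qed.

Let rhoip : rhoi p = p. Proof. by rewrite -{1}rhop rhoK. Qed.

(** The stages are eventually constant near every point other than [r'], and
they send the ends [~ D (iter j etai x)], which shrink to [r'], to ends that
shrink to [p]; so their limit extends to [r'] by the value [p]. *)
Lemma telescope : exists theta : X -> X,
  [/\ homeomorphism theta, forall x, D x -> theta x = w x & theta r' = p].
Proof.
have /choice[j hj] : forall x, exists j, x <> r' ->
    \forall y \near x, D (iter j etai y).
  move=> x; have [->|xr'] := EM (x = r'); first by exists 0%N.
  by have [j hj] := eta_exhaust xr'; exists j.
have jD x : x <> r' -> D (iter (j x) etai x).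
  by move=> xr'; exact: nbhs_singleton (hj x xr').
pose theta x := if `[< x = r' >] then p else stage (j x) x.
have thr' : theta r' = p by rewrite /theta asboolT.
have thE x k : D (iter k etai x) -> theta x = stage k x.
  move=> Dk; have xr' : x <> r' by move=> e; rewrite e iter_fix in Dk.
  rewrite /theta asboolF//; have [/stage_stable-> //|/ltnW kj] := leqP k (j x).
  by symmetry; apply: stage_stable => //; exact: jD.
have thB x k : ~ D (iter k etai x) ->
    ~ E (iter k.+1 rhoi (theta x)).
  move=> Dk; have [->|xr'] := EM (x = r').
    by rewrite thr' iter_fix.
  have jx := jD _ xr'.
  rewrite (thE _ _ jx); have [kj|jk] := leqP k (j x).
    by move=> /(stage_iterE _ kj).
  exfalso; apply: Dk; rewrite -(subnK (ltnW jk)) iterD.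
  by elim: (k - j x)%N => //= i; exact: etaiD.
have thp x : x <> r' -> theta x <> p.
  move=> xr' e; have jx := jD _ xr'.
  apply: Np; rewrite -(iter_fix (f := rhoi) (j x).+1 rhoip) -e (thE _ _ jx).
  exact/stage_iterE.
exists theta; split=> //; last by move=> x Dx; exact: (thE x 0%N).
apply: compact_hausdorff_homeomorphism => //.
- move=> x; have [->|xr'] := EM (x = r').
    rewrite /continuous_at thr' => N /rho_shrink[k hk].
    have : nbhs r' (~` (iter k etai @^-1` D)).
      apply: open_nbhs_nbhs; split; last by rewrite /= iter_fix.
      have [ck _] := iter_homeomorphism k hetai.
      by apply: closed_openC; move/continuous_closedP : ck; exact.
    apply: filterS => y Dy; apply: hk => Ek; apply: (thB y k) => //.
    exact: rhoiE.
  have jx := jD _ xr'; rewrite /continuous_at (thE _ _ jx).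
  have [cs _] := homeomorphism_stage (j x).
  move=> N Nsx; have Nx : nbhs x (stage (j x) @^-1` N) by exact: cs Nsx.
  have NDx : nbhs x ((stage (j x) @^-1` N) `&` [set y | D (iter (j x) etai y)]).
    by apply: filterI => //; exact: hj.
  by apply: filterS NDx => y [Ny Dy]; rewrite /= (thE _ _ Dy).
- move=> x y e.
  have [xr'|xr'] := EM (x = r').
    have [->//|yr'] := EM (y = r').
    by case: (thp y yr'); rewrite -e xr'.
  have [yr'|yr'] := EM (y = r'); first by case: (thp x xr'); rewrite e yr'.
  have jx := jD _ xr'; have jy := jD _ yr'.
  pose k := maxn (j x) (j y).
  apply: (homeomorphism_inj (homeomorphism_stage k)).
  rewrite (stage_stable jx) ?leq_maxl// (stage_stable jy) ?leq_maxr//.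
  by rewrite -!thE.
- move=> z; have [->|zp] := EM (z = p); first by exists r'.
  have : nbhs p (~` [set z]).
    apply: open_nbhs_nbhs; split; last by move=> /= e; apply: zp.
    by apply: closed_openC; exact/accessible_closed_set1/hausdorff_accessible.
  move=> /rho_shrink[k /(_ z) hk].
  have Ek : E (iter k rhoi z) by apply: contrapT => /hk; exact.
  have [st' [_ _ st'K]] := homeomorphism_inv (homeomorphism_stage k).
  exists (st' z); rewrite (thE _ k) ?st'K//.
  by apply/(stage_iterE _ (leqnn k)); rewrite st'K; exact: rhoiE.
Qed.

End Telescope.

(** * Piecewise linear moves of the line *)

Section PiecewiseLinear.
Variable R : realType.
Implicit Types s c d e t u : R.

(** The piecewise linear bijection of the line that moves the level [c] to the
level [d] and moves nothing outside of the interval from [s] to [e]. *)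
Definition pl_move s c d e t : R :=
  if t <= s then t
  else if t <= c then s + (d - s) / (c - s) * (t - s)
  else if t <= e then e - (e - d) / (e - c) * (e - t)
  else t.

Section Bijection.
Variables s c d e : R.
Hypotheses (sc : s < c) (ce : c < e) (sd : s < d) (de : d < e).

Let csN0 : c - s != 0. Proof. by rewrite subr_eq0 gt_eqF. Qed.
Let ecN0 : e - c != 0. Proof. by rewrite subr_eq0 gt_eqF. Qed.
Let dsN0 : d - s != 0. Proof. by rewrite subr_eq0 gt_eqF. Qed.
Let edN0 : e - d != 0. Proof. by rewrite subr_eq0 gt_eqF. Qed.

Lemma pl_move_low t : t <= s -> pl_move s c d e t = t.
Proof. by rewrite /pl_move => ->. Qed.

Lemma pl_move_high t : e <= t -> pl_move s c d e t = t.
Proof.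
have [[[h1 h2] h3] h4] := (sc, ce, sd, de).
rewrite /pl_move => et; case: (leP t s) => // ts.
case: (leP t c) => tc; first by lra.
case: (leP t e) => // te; have -> : t = e by lra.
by rewrite subrr mulr0 subr0.
Qed.

Lemma pl_move_node : pl_move s c d e c = d.
Proof.
have [[[h1 h2] h3] h4] := (sc, ce, sd, de).
by rewrite /pl_move lexx leNgt sc /= divfK//; ring.
Qed.

(* The slopes of the two middle pieces, with the only facts about them that
   the case analysis below uses. *)
Let A := (d - s) / (c - s).
Let B := (e - d) / (e - c).
Let Ap : 0 < A. Proof. by rewrite divr_gt0 ?subr_gt0. Qed.
Let Bp : 0 < B. Proof. by rewrite divr_gt0 ?subr_gt0. Qed.
Let AE : A * (c - s) = d - s. Proof. by rewrite /A divfK. Qed.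
Let BE : B * (e - c) = e - d. Proof. by rewrite /B divfK. Qed.

Lemma pl_move_ltr t u : t < u -> pl_move s c d e t < pl_move s c d e u.
Proof.
have [[[h1 h2] h3] h4] := (sc, ce, sd, de).
have [[[hA hB] hAE] hBE] := (Ap, Bp, AE, BE).
move=> tu; rewrite /pl_move -/A -/B.
have At : 0 < A * (u - t) by rewrite mulr_gt0//; lra.
have Bt : 0 < B * (u - t) by rewrite mulr_gt0//; lra.
case: (leP t s) => ts; case: (leP u s) => us; try lra.
- case: (leP u c) => uc.
    have : 0 < A * (u - s) by rewrite mulr_gt0//; lra.
    lra.
  case: (leP u e) => ue; try lra.
  have : 0 < B * (u - c) by rewrite mulr_gt0//; lra.
  lra.
- have As : 0 < A * (t - s) by rewrite mulr_gt0//; lra.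
  case: (leP t c) => tc; case: (leP u c) => uc; try lra.
    have : 0 <= A * (c - t) by rewrite mulr_ge0//; lra.
    case: (leP u e) => ue; try lra.
    have : 0 < B * (u - c) by rewrite mulr_gt0//; lra.
    lra.
  case: (leP t e) => te; case: (leP u e) => ue; try lra.
  have : 0 <= B * (e - t) by rewrite mulr_ge0//; lra.
  lra.
Qed.

Lemma pl_move_ltE t u : (pl_move s c d e t < pl_move s c d e u) = (t < u).
Proof.
have [[[h1 h2] h3] h4] := (sc, ce, sd, de).
apply/idP/idP; [|exact: pl_move_ltr].
by case: (ltgtP t u) => // [/pl_move_ltr|->]; lra.
Qed.

Lemma pl_move_leE t u : (pl_move s c d e t <= pl_move s c d e u) = (t <= u).
Proof. by rewrite !leNgt pl_move_ltE. Qed.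

Lemma pl_move_inv t : pl_move s d c e (pl_move s c d e t) = t.
Proof.
have [[[h1 h2] h3] h4] := (sc, ce, sd, de).
have [[[hA hB] hAE] hBE] := (Ap, Bp, AE, BE).
rewrite {2}/pl_move -/A -/B.
case: (leP t s) => ts; first by rewrite /pl_move ts.
have As : 0 < A * (t - s) by rewrite mulr_gt0//; lra.
case: (leP t c) => tc.
  have : 0 <= A * (c - t) by rewrite mulr_ge0//; lra.
  move=> Ac; rewrite /pl_move ifF; last by apply/negbTE; lra.
  rewrite ifT; last by lra.
  by rewrite /A; field; rewrite csN0 dsN0.
case: (leP t e) => te.
  have Bc : 0 < B * (t - c) by rewrite mulr_gt0//; lra.
  have Be : 0 <= B * (e - t) by rewrite mulr_ge0//; lra.
  rewrite /pl_move ifF; last by apply/negbTE; lra.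
  rewrite ifF; last by apply/negbTE; lra.
  rewrite ifT; last by lra.
  by rewrite /B; field; rewrite ecN0 edN0.
rewrite /pl_move; case: (leP t s) => // _; case: (leP t d) => td; first by lra.
by case: (leP t e) => // te'; lra.
Qed.

Lemma pl_move_upper t : c <= t -> t <= e ->
  e - pl_move s c d e t = (e - d) / (e - c) * (e - t).
Proof.
have [[[h1 h2] h3] h4] := (sc, ce, sd, de).
have [hB hBE] := (Bp, BE).
rewrite /pl_move -/A -/B => ct te; case: (leP t s) => ts; first by lra.
case: (leP t c) => tc; last by rewrite te; lra.
have -> : t = c by lra.
by rewrite /A /B; field; rewrite csN0 ecN0.
Qed.

Lemma pl_move_between t : s < t -> t < e -> s < pl_move s c d e t < e.
Proof.
have [[[h1 h2] h3] h4] := (sc, ce, sd, de).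
move=> /pl_move_ltr ts /pl_move_ltr te.
by move: ts te; rewrite (pl_move_low (lexx s)) (pl_move_high (lexx e)) => -> ->.
Qed.

Lemma pl_move_ramps t : pl_move s c d e t = t
  + ((d - s) / (c - s) - 1) * Num.max 0 (t - s)
  + ((e - d) / (e - c) - (d - s) / (c - s)) * Num.max 0 (t - c)
  + (1 - (e - d) / (e - c)) * Num.max 0 (t - e).
Proof.
have [[[h1 h2] h3] h4] := (sc, ce, sd, de).
have [[[hA hB] hAE] hBE] := (Ap, Bp, AE, BE).
rewrite /pl_move -/A -/B.
case: (leP t s) => ts; first by rewrite !max_l; [ring|lra..].
rewrite [Num.max 0 (t - s)]max_r; last by lra.
case: (leP t c) => tc; first by rewrite !max_l; [ring|lra..].
rewrite [Num.max 0 (t - c)]max_r; last by lra.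
case: (leP t e) => te.
  by rewrite max_l; [lra|lra].
by rewrite max_r; [lra|lra].
Qed.

End Bijection.

(** The sum of ramps [pl_move_ramps] shows that the move is jointly continuous in
the target level and in the moved point. *)
Lemma continuous_pl_move (T : topologicalType) (f t : T -> R) s c e :
  s < c -> c < e -> continuous f -> continuous t ->
  (forall x, s < f x < e) -> continuous (fun x => pl_move s c (f x) e (t x)).
Proof.
move=> sc ce cf ct fse.
have -> : (fun x => pl_move s c (f x) e (t x)) = fun x => t x
  + ((f x - s) / (c - s) - 1) * Num.max 0 (t x - s)
  + ((e - f x) / (e - c) - (f x - s) / (c - s)) * Num.max 0 (t x - c)
  + (1 - (e - f x) / (e - c)) * Num.max 0 (t x - e).
  by apply/funext => x; have /andP[sf fe] := fse x; exact: pl_move_ramps.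
move=> x.
have kc r : {for x, continuous (fun _ : T => r : R^o)} by exact: cvg_cst.
have fB r : {for x, continuous (fun y => f y - r)}.
  by apply: continuousB; [exact: cf|exact: kc].
have Bf r : {for x, continuous (fun y => r - f y)}.
  by apply: continuousB; [exact: kc|exact: cf].
have tB r : {for x, continuous (fun y => Num.max 0 (t y - r))}.
  have tr : {for x, continuous (fun y => t y - r)}.
    by apply: continuousB; [exact: ct|exact: kc].
  exact: (@continuous_max R T (fun _ => 0) (fun y => t y - r) x (kc 0) tr).
have fM r q : {for x, continuous (fun y => (f y - r) / q)}.
  by apply: continuousM; [exact: fB|exact: kc].
have Mf r q : {for x, continuous (fun y => (r - f y) / q)}.
  by apply: continuousM; [exact: Bf|exact: kc].
pose k1 y := (f y - s) / (c - s) - 1.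
pose k2 y := (e - f y) / (e - c) - (f y - s) / (c - s).
pose k3 y := 1 - (e - f y) / (e - c).
have k1c : {for x, continuous k1} by apply: continuousB; [exact: fM|exact: kc].
have k2c : {for x, continuous k2} by apply: continuousB; [exact: Mf|exact: fM].
have k3c : {for x, continuous k3} by apply: continuousB; [exact: kc|exact: Mf].
exact: (continuousD (continuousD (continuousD (ct x)
  (continuousM k1c (tB s))) (continuousM k2c (tB c))) (continuousM k3c (tB e))).
Qed.

End PiecewiseLinear.

Lemma pl_move_refl (R : realType) (s c e t : R) : s < c -> c < e ->
  pl_move s c c e t = t.
Proof.
move=> sc ce; rewrite pl_move_ramps// !divff ?subr_eq0 ?gt_eqF//.
by rewrite subrr !mul0r !addr0.
Qed.

(** * Suspension structures and slides along their rays *)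

(** The part of a suspension structure that the swindle uses, in a form that
homeomorphisms transport: [ht] is the height, between [-1] and [1], and
[pt x t] is the point of height [t] on the ray of [x].  A point of height [-1]
or [1] lies on all the rays, which is why [pt_pt] excludes these heights. *)
Record axis (R : realType) (X : topologicalType) := Axis {
  ht : X -> R;
  pt : X -> R -> X;
  ht_continuous : continuous ht;
  ht_bound : forall x, -1 <= ht x <= 1;
  ht_bot_inj : forall x y, ht x = -1 -> ht y = -1 -> x = y;
  ht_top_inj : forall x y, ht x = 1 -> ht y = 1 -> x = y;
  ht_pt : forall x t, -1 <= t <= 1 -> ht (pt x t) = t;
  pt_ht : forall x, pt x (ht x) = x;
  pt_pt : forall x t u, -1 < t < 1 -> pt (pt x t) u = pt x u;
  slide_subproof : forall s c d e, -1 <= s -> s < c -> c < e ->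
    s < d -> d < e -> e <= 1 ->
    homeomorphism (fun x => pt x (pl_move s c d e (ht x)))
}.

Definition slide R X (A : axis R X) s c d e x :=
  pt A x (pl_move s c d e (ht A x)).

Definition admissible (R : realType) (s c d e : R) :=
  [&& -1 <= s, s < c, c < e, s < d, d < e & e <= 1].

Lemma admissibleC (R : realType) (s c d e : R) :
  admissible s c d e -> admissible s d c e.
Proof.
by move=> /and5P[? ? ? ? /andP[? ?]]; apply/and5P; split=> //; apply/andP.
Qed.

Section Slide.
Variables (R : realType) (X : topologicalType) (A : axis R X).
Variables s c d e : R.
Hypothesis adm : admissible s c d e.

Lemma homeomorphism_slide : homeomorphism (slide A s c d e).
Proof. by move: adm => /and5P[? ? ? ? /andP[? ?]]; exact: slide_subproof. Qed.

Lemma slide_fix x : ht A x <= s \/ e <= ht A x -> slide A s c d e x = x.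
Proof.
move: adm => /and5P[? ? ? ? /andP[? ?]]; rewrite /slide => -[xs|ex].
  by rewrite pl_move_low// pt_ht.
by rewrite pl_move_high// pt_ht.
Qed.

Lemma slide_ht x : ht A (slide A s c d e x) = pl_move s c d e (ht A x).
Proof.
move: adm => /and5P[h1 ? ? ? /andP[? h2]].
have [xs|sx] := leP (ht A x) s; first by rewrite slide_fix ?pl_move_low//; left.
have [ex|xe] := leP e (ht A x).
  by rewrite slide_fix ?pl_move_high//; right.
have /andP[k1 k2] : s < pl_move s c d e (ht A x) < e by exact: pl_move_between.
by rewrite ht_pt//; apply/andP; split; lra.
Qed.

Lemma slide_node x : ht A x = c -> slide A s c d e x = pt A x d.
Proof.
move: adm => /and5P[? ? ? ? /andP[? ?]].
by rewrite /slide => ->; rewrite pl_move_node.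
Qed.

Lemma slide_le_node x : (ht A (slide A s c d e x) <= d) = (ht A x <= c).
Proof.
move: adm => /and5P[? ce ? ? /andP[? ?]].
have kc : pl_move s c d e c = d by exact: pl_move_node.
by rewrite slide_ht -(@pl_move_leE R s c d e _ _ _ _ (ht A x) c)// kc.
Qed.

Lemma slide_lt_high x : (ht A (slide A s c d e x) < e) = (ht A x < e).
Proof.
move: adm => /and5P[? ? ? ? /andP[? ?]]; rewrite slide_ht.
have ke : pl_move s c d e e = e by exact: pl_move_high.
by rewrite -(@pl_move_ltE R s c d e _ _ _ _ (ht A x) e)// ke.
Qed.

Lemma slide_gt_low x : (s < ht A (slide A s c d e x)) = (s < ht A x).
Proof.
move: adm => /and5P[? ? ? ? /andP[? ?]]; rewrite slide_ht.
have ks : pl_move s c d e s = s by exact: pl_move_low.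
by rewrite -(@pl_move_ltE R s c d e _ _ _ _ s (ht A x))// ks.
Qed.

Lemma slideK : cancel (slide A s c d e) (slide A s d c e).
Proof.
move=> x; have [xs|sx] := leP (ht A x) s.
  by move: (admissibleC adm) => /and5P[? ? ? ? /andP[? ?]];
    rewrite slide_fix; [rewrite /slide pl_move_low// pt_ht|left].
have [ex|xe] := leP e (ht A x).
  by move: (admissibleC adm) => /and5P[? ? ? ? /andP[? ?]];
    rewrite slide_fix; [rewrite /slide pl_move_high// pt_ht|right].
rewrite {1}/slide slide_ht.
move: adm => /and5P[h1 ? ? ? /andP[? h2]].
have /andP[k1 k2] : s < pl_move s c d e (ht A x) < e by exact: pl_move_between.
rewrite pl_move_inv// /slide pt_pt ?pt_ht//; apply/andP; split; lra.
Qed.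

End Slide.

Lemma pullback_axis (R : realType) (X Z : topologicalType) (A : axis R Z)
    (g : X -> Z) : homeomorphism g ->
  exists B : axis R X, forall x, ht B x = ht A (g x).
Proof.
move=> hg; have [gi [hgi gK giK]] := homeomorphism_inv hg.
have ginj := homeomorphism_inj hg.
unshelve refine (ex_intro _ (@Axis R X (fun x => ht A (g x))
  (fun x t => gi (pt A (g x) t)) _ _ _ _ _ _ _ _) _) => //=.
- move=> x; apply: (@continuous_comp _ _ _ g (ht A)); last exact: ht_continuous.
  by case: hg => cg _; exact: cg.
- by move=> x; exact: ht_bound.
- by move=> x y x1 y1; apply: ginj; exact: ht_bot_inj x1 y1.
- by move=> x y x1 y1; apply: ginj; exact: ht_top_inj x1 y1.
- by move=> x t t1; rewrite giK ht_pt.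
- by move=> x; rewrite pt_ht gK.
- by move=> x t u t1; rewrite giK pt_pt.
- move=> s c d e s1 sc ce sd de e1.
  apply: (homeomorphism_comp (homeomorphism_comp hg
    (slide_subproof A s1 sc ce sd de e1)) hgi).
Qed.

Lemma continuous_le_closed (R : realType) (X : topologicalType) (h : X -> R) t :
  continuous h -> closed [set x | h x <= t].
Proof. by move=> /continuous_closedP/(_ _ (@closed_le R t)). Qed.

Lemma continuous_ge_closed (R : realType) (X : topologicalType) (h : X -> R) t :
  continuous h -> closed [set x | t <= h x].
Proof. by move=> /continuous_closedP/(_ _ (@closed_ge R t)). Qed.

Lemma geometric_lt (R : realType) (m b eps : R) : 0 <= m < 1 -> 0 < eps ->
  exists k : nat, m ^+ k * b < eps.
Proof.
move=> /andP[m0 m1] eps0; have [b0|b0] := leP b 0.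
  by exists 0%N; rewrite expr0 mul1r; apply: le_lt_trans b0 eps0.
have m1' : `|m| < 1 by rewrite ger0_norm.
have /cvgrPdist_lt /(_ (eps / b)) := cvg_expr m1'.
rewrite divr_gt0// => /(_ isT)[k _ /(_ k (leqnn k))] /=.
rewrite sub0r normrN ger0_norm ?exprn_ge0// => mk; exists k.
by rewrite -ltr_pdivlMr.
Qed.

Section Iterates.
Variables (R : realType) (X : topologicalType) (A : axis R X).

(** Above the level [c] the slide contracts the distance to the top level by a
constant factor. *)
Lemma slide_push_top p N c d : compact [set: X] -> ht A p = 1 ->
  -1 < c -> c < d -> d < 1 -> nbhs p N ->
  exists j, forall y, c <= ht A y -> N (iter j (slide A (-1) c d 1) y).
Proof.
move=> cX Ap c1 cd d1 Np.
have cN : closed (~` N°) by apply: open_closedC; exact: open_interior.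
have topN x : (~` N°) x -> ht A x < 1.
  move=> Nx; have /andP[_] := ht_bound A x.
  rewrite le_eqVlt => /orP[/eqP x1|//].
  by exfalso; apply: Nx; rewrite (ht_top_inj x1 Ap).
have N11 : -1 < 1 :> R by lra.
have [l [_ l1 lP]] :=
  compact_below_level cX (ht_continuous (a := A)) cN topN N11.
have {topN cN} lP x : l <= ht A x -> N x.
  move=> lx; apply: (@interior_subset _ N x); apply: contrapT => /lP; lra.
have c1' : c < 1 by lra.
pose m := (1 - d) / (1 - c).
have m01 : 0 <= m < 1.
  apply/andP; split; first by rewrite divr_ge0//; lra.
  by rewrite ltr_pdivrMr; lra.
have l1' : 0 < 1 - l by lra.
have [j mj] := geometric_lt 2 m01 l1'.
exists j => y yc; apply: lP.
suff [_ jE] : c <= ht A (iter j (slide A (-1) c d 1) y) /\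
    1 - ht A (iter j (slide A (-1) c d 1) y) = m ^+ j * (1 - ht A y).
  have /andP[yl _] := ht_bound A y.
  have m0 : 0 <= m ^+ j by rewrite exprn_ge0//; case/andP: m01.
  have mle : m ^+ j * (1 - ht A y) <= m ^+ j * 2 by rewrite ler_wpM2l//; lra.
  lra.
elim: (j) => [|i [IH1 IH2]]; first by rewrite expr0 mul1r.
set z := iter i _ y in IH1 IH2.
have /andP[_ z1] := ht_bound A z.
rewrite iterS -/z slide_ht; last by apply/and5P; split; rewrite ?d1; lra.
have kE : 1 - pl_move (-1) c d 1 (ht A z) = m * (1 - ht A z).
  by apply: pl_move_upper => //; lra.
rewrite kE exprS -mulrA -IH2; split=> //.
have : pl_move (-1) c d 1 c <= pl_move (-1) c d 1 (ht A z).
  by rewrite pl_move_leE//; lra.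
by rewrite pl_move_node//; lra.
Qed.

Lemma slide_pull_top x c d : -1 < d -> d < c -> c < 1 -> ht A x < 1 ->
  exists j, ht A (iter j (slide A (-1) c d 1) x) < c.
Proof.
move=> d1 dc c1 x1; apply: contrapT => /forallNP xj.
have {}xj j : c <= ht A (iter j (slide A (-1) c d 1) x).
  by rewrite leNgt; apply/negP/xj.
pose m := (1 - c) / (1 - d).
have m01 : 0 <= m < 1.
  apply/andP; split; first by rewrite divr_ge0//; lra.
  by rewrite ltr_pdivrMr; lra.
have x1' : 0 < 1 - ht A x by lra.
have [j mj] := geometric_lt (1 - c) m01 x1'.
have mE : 1 - ht A x = m ^+ j * (1 - ht A (iter j (slide A (-1) c d 1) x)).
  elim: (j) => [|i ->]; first by rewrite expr0 mul1r.
  have zc := xj i; set z := iter i _ x in zc *.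
  have /andP[_ z1] := ht_bound A z.
  rewrite iterS -/z slide_ht; last by apply/and5P; split; rewrite ?d1; lra.
  have kE : 1 - pl_move (-1) c d 1 (ht A z) = (1 - d) / (1 - c) * (1 - ht A z).
    by apply: pl_move_upper => //; lra.
  rewrite kE exprSr -mulrA; congr (_ * _); rewrite /m; field.
  by rewrite !subr_eq0 !gt_eqF//; lra.
have mj0 : 0 <= m ^+ j by rewrite exprn_ge0//; case/andP: m01.
have xjj := xj j.
have mle : m ^+ j * (1 - ht A (iter j (slide A (-1) c d 1) x)) <=
    m ^+ j * (1 - c).
  by rewrite ler_wpM2l//; lra.
lra.
Qed.

End Iterates.

(** * The swindle *)

(** The balls of the swindle are [V = {A <= t0}] and [W = {B <= u0}].  The
levels [lo], [hi] are those of [B]-balls just inside and just outside of [V],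
and [lo'], [hi'] those of [A]-balls just inside and just outside of [W]; the
remaining levels [s], [e], [s'], [e'] bound the slides, so that a slide of one
structure fixes the relevant ball of the other. *)
Section Swindle.
Variables (R : realType) (X : topologicalType) (A B : axis R X).
Hypotheses (cX : compact [set: X]) (hX : hausdorff_space X).
Variables s t0 e s' u0 e' lo hi lo' hi' : R.
Hypotheses (adm_v1 : admissible (-1) lo u0 e')
  (adm_v2 : admissible s t0 hi' 1) (adm_rho : admissible (-1) lo' hi' 1)
  (adm_w2 : admissible s' hi u0 1) (adm_w3 : admissible (-1) t0 lo' e)
  (adm_eta : admissible (-1) hi lo 1).
Hypotheses (lohi : lo < hi) (lo'hi' : lo' < hi').
Hypotheses (loP : forall x, ht B x <= lo -> ht A x < s)
  (hiP : forall x, ht A x <= e -> ht B x < hi)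
  (lo'P : forall x, ht A x <= lo' -> ht B x < s')
  (hi'P : forall x, ht B x <= e' -> ht A x < hi').

Let v1 := slide B (-1) lo u0 e'.
Let v2 := slide A s t0 hi' 1.
Let rho := slide A (-1) lo' hi' 1.
Let rhoi := slide A (-1) hi' lo' 1.
Let w2 := slide B s' hi u0 1.
Let w3 := slide A (-1) t0 lo' e.
Let etai := slide B (-1) hi lo 1.
(* [v] carries the layer between {B <= lo} and [V] to the layer between [W]
   and {A <= hi'}, and [w'] carries the layer between [V] and {B <= hi} to the
   image under [rho] of the layer between {A <= lo'} and [W]. *)
Let v := v1 \o v2.
Let w' := rho \o w2 \o w3.
Let w x := if `[< ht A x <= t0 >] then v x else w' x.

Let rhoK : cancel rho rhoi. Proof. exact: slideK. Qed.
Let rhoiK : cancel rhoi rho. Proof. exact/slideK/admissibleC. Qed.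

Let st : s < t0. Proof. by case/and5P: adm_v2. Qed.
Let te : t0 < e. Proof. by case/and5P: adm_w3. Qed.
Let su : s' < u0. Proof. by case/and5P: adm_w2. Qed.
Let ue : u0 < e'. Proof. by case/and5P: adm_v1 => _ _ _ _ /andP[]. Qed.
Let lo1 : -1 < lo. Proof. by case/and5P: adm_v1. Qed.
Let hi1 : hi < 1. Proof. by case/and5P: adm_eta. Qed.
Let lo'1 : -1 < lo'. Proof. by case/and5P: adm_rho. Qed.
Let hi'1 : hi' < 1. Proof. by case/and5P: adm_rho => _ _ _ _ /andP[]. Qed.

Let ht_pt_mid (C : axis R X) x t : -1 < t -> t < 1 -> ht C (pt C x t) = t.
Proof. by move=> t1 t2; apply: ht_pt; rewrite !ltW. Qed.

Let pt_pt_mid (C : axis R X) x t u :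
  -1 < t -> t < 1 -> pt C (pt C x t) u = pt C x u.
Proof. by move=> t1 t2; apply: pt_pt; rewrite t1. Qed.

Let v1A y : (ht A (v1 y) <= hi') = (ht A y <= hi').
Proof.
have [ye|ye] := leP e' (ht B y).
  by rewrite /v1 slide_fix//; right.
have ye' : ht B (v1 y) < e' by rewrite slide_lt_high.
by rewrite (ltW (hi'P (ltW ye))) (ltW (hi'P (ltW ye'))).
Qed.

Let vE x : ht A x <= t0 <-> ht A (v x) <= hi'.
Proof. by rewrite v1A slide_le_node. Qed.

Let w2A y : (ht A (w2 y) <= lo') = (ht A y <= lo').
Proof.
have [ys|ys] := leP (ht B y) s'.
  by rewrite /w2 slide_fix//; left.
have ys' : s' < ht B (w2 y) by rewrite slide_gt_low.
have far z : s' < ht B z -> lo' < ht A z.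
  by rewrite !ltNge; apply: contra => /lo'P/ltW.
by rewrite !leNgt !far.
Qed.

Let w'E x : ht A x <= t0 <-> ht A (w' x) <= hi'.
Proof. by rewrite slide_le_node// w2A slide_le_node. Qed.

(* On the boundary of [V], both maps slide along the [A]-rays to the level
   [hi']: their [B]-slides do not reach that far. *)
Let vw' x : ht A x <= t0 -> t0 <= ht A x -> v x = w' x.
Proof.
move=> x1 x2; have xt : ht A x = t0 by apply: le_anti; rewrite x1.
have hi'm1 : -1 < hi' := lt_trans lo'1 lo'hi'.
have lo'1' : lo' < 1 := lt_trans lo'hi' hi'1.
have v2x : v2 x = pt A x hi' by exact: slide_node.
have w3x : w3 x = pt A x lo' by exact: slide_node.
have v1x : v1 (pt A x hi') = pt A x hi'.
  apply: slide_fix => //; right; rewrite leNgt; apply/negP => /ltW/hi'P.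
  by rewrite ht_pt_mid// ltxx.
have w2x : w2 (pt A x lo') = pt A x lo'.
  by apply: slide_fix => //; left; apply/ltW/lo'P; rewrite ht_pt_mid.
have rhox : rho (pt A x lo') = pt A (pt A x lo') hi'.
  by apply: slide_node => //; rewrite ht_pt_mid.
by rewrite /v /w' /= v2x w3x v1x w2x rhox pt_pt_mid.
Qed.

Let hw : homeomorphism w.
Proof.
have cA := ht_continuous (a := A).
apply: (homeomorphism_glue (C := [set x | ht A x <= t0])
  (D := [set x | t0 <= ht A x]) (C' := [set x | ht A x <= hi'])) => //.
- exact: continuous_le_closed.
- exact: continuous_ge_closed.
- by move=> x /=; case: (leP (ht A x) t0) => [|/ltW]; [left|right].
- by apply: homeomorphism_comp; exact: homeomorphism_slide.
- apply: homeomorphism_comp; first exact: homeomorphism_slide.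
  by apply: homeomorphism_comp; exact: homeomorphism_slide.
Qed.

Let winj := homeomorphism_inj hw.

Let w_lo x : ht B x <= lo -> w x = v1 x.
Proof.
move=> /loP xs; have xt : ht A x <= t0 := ltW (lt_trans xs st).
by rewrite /w asboolT// /v /= /v2 slide_fix//; left; exact: ltW.
Qed.

Let w_hi x : hi <= ht B x -> w x = rho (w2 x).
Proof.
move=> xhi; have ex : e < ht A x.
  by rewrite ltNge; apply/negP => /hiP; rewrite ltNge xhi.
rewrite /w asboolF; last by apply/negP; rewrite -ltNge (lt_trans te).
by rewrite /w' /= /w3 slide_fix//; right; exact: ltW.
Qed.

Let w_lowE x : ht B x <= lo <-> ht B (w x) <= u0.
Proof.
split=> [xlo|wx]; first by rewrite w_lo// slide_le_node.
pose x1 := slide B (-1) u0 lo e' (w x).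
have x1lo : ht B x1 <= lo by rewrite slide_le_node//; exact: admissibleC.
suff -> : x = x1 by [].
by apply: winj; rewrite (w_lo x1lo) /v1 /x1 slideK//; exact: admissibleC.
Qed.

Let w_highE x : ht B x <= hi <-> ht B (rhoi (w x)) <= u0.
Proof.
have adm_w2' := admissibleC adm_w2.
rewrite !leNgt; split=> /negP xP; apply/negP => xhi; apply: xP.
  pose x1 := slide B s' u0 hi 1 (rhoi (w x)).
  have x1hi : hi < ht B x1 by rewrite ltNge slide_le_node// -ltNge.
  suff -> : x = x1 by [].
  by apply: winj; rewrite (w_hi (ltW x1hi)) /w2 /x1 slideK// rhoiK.
by rewrite w_hi ?(ltW xhi)// rhoK ltNge slide_le_node// -ltNge.
Qed.

(* On the two ends of the layer {lo <= B <= hi}, [w] slides along the [B]-rays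
   to the level [u0], up to [rho] on the outer end. *)
Let w_periodic x : ht B x = hi -> w x = rho (w (etai x)).
Proof.
move=> xhi; have lo_lt1 : lo < 1 := lt_trans lohi hi1.
have ex : etai x = pt B x lo by exact: slide_node.
rewrite w_hi ?xhi// ex w_lo ?ht_pt_mid//; congr rho.
by rewrite /w2 slide_node// /v1 slide_node ?ht_pt_mid// pt_pt_mid.
Qed.

Lemma swindle_levels p r r' : ht A p = 1 -> ht B r = -1 -> ht B r' = 1 ->
  u0 < ht B p ->
  exists theta : X -> X, [/\ homeomorphism theta, theta r = r & theta r' = p].
Proof.
move=> Ap Br Br' up.
have [th [hth thw thr']] : exists theta : X -> X,
    [/\ homeomorphism theta, forall x, ht B x <= hi -> theta x = w x
      & theta r' = p].
  apply: (telescope (U := [set x | ht B x <= lo])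
    (D := [set x | ht B x <= hi]) (D' := [set x | hi <= ht B x])
    (E := [set x | ht B x <= u0])
    (rho := rho) (rhoi := rhoi) (etai := etai)) => //=.
  - exact: homeomorphism_slide.
  - exact: homeomorphism_slide.
  - exact/continuous_le_closed/ht_continuous.
  - exact/continuous_ge_closed/ht_continuous.
  - by move=> x; case: (leP (ht B x) hi) => [|/ltW]; [left|right].
  - by move=> x /= /le_trans -> //; exact: ltW.
  - by move=> x; rewrite slide_le_node.
  - by move=> x x1 x2; apply: w_periodic; apply: le_anti; rewrite x1.
  - by apply: slide_fix => //; right; rewrite Ap.
  - by apply/negP; rewrite -ltNge.
  - move=> N Np; have [j jP] := slide_push_top cX Ap lo'1 lo'hi' hi'1 Np.
    exists j => z /negP; rewrite -ltNge => zj.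
    have -> : z = iter j rho (iter j rhoi z).
      by elim: (j) => // k IH; rewrite iterSr iterS rhoiK.
    apply: jP; rewrite leNgt; apply/negP => /ltW/lo'P.
    by move=> /lt_trans/(_ su)/(lt_trans zj); rewrite ltxx.
  - by apply: slide_fix => //; right; rewrite Br'.
  - by apply/negP; rewrite -ltNge Br'.
  - move=> x xr'.
    have x1 : ht B x < 1.
      rewrite lt_neqAle; have /andP[_ ->] := ht_bound B x.
      by rewrite andbT; apply/eqP => x1; apply: xr'; exact: ht_top_inj x1 Br'.
    have [j xj] := slide_pull_top lo1 lohi hi1 x1.
    exists j; have [cj _] : homeomorphism (iter j etai).
      exact/iter_homeomorphism/homeomorphism_slide.
    have /cvgr_lt : ht B (iter j etai y) @[y --> x] --> ht B (iter j etai x).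
      by apply: continuous_comp; [exact: cj|exact: ht_continuous].
    by move=> /(_ _ xj); apply: filterS => y /ltW.
have rlo : ht B r <= lo by rewrite Br ltW.
exists th; split=> //; rewrite thw ?(le_trans rlo) ?(ltW lohi)// w_lo//.
by rewrite /v1 slide_fix//; left; rewrite Br.
Qed.

End Swindle.

(** Compactness provides the levels: a ball that contains a pole of the other
structure in its interior contains a small ball around that pole, and a ball
that avoids a pole is contained in a large ball around the opposite pole. *)
Lemma swindle (R : realType) (X : topologicalType) (A B : axis R X)
    (p' p r r' : X) : compact [set: X] -> hausdorff_space X ->
  ht A p' = -1 -> ht A p = 1 -> ht B r = -1 -> ht B r' = 1 ->
  ht A r < ht A r' -> ht B p' < ht B p ->
  exists theta : X -> X, [/\ homeomorphism theta, theta r = r & theta r' = p].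
Proof.
move=> cX hX Ap' Ap Br Br' Arr' Bpp'.
have pick a b : -1 <= a -> b <= 1 -> a < b :> R -> exists s t e,
    [/\ a < s, s < t, t < e & e < b].
  move=> _ _ ab; exists ((a * 3 + b) / 4), ((a + b) / 2), ((a + b * 3) / 4).
  by split; lra.
have [/andP[r_ge _] /andP[_ r'_le]] := (ht_bound A r, ht_bound A r').
have [/andP[p'_ge _] /andP[_ p_le]] := (ht_bound B p', ht_bound B p).
have [s [t0 [e [rs st te er']]]] := pick _ _ r_ge r'_le Arr'.
have [s' [u0 [e' [ps' su ue ep]]]] := pick _ _ p'_ge p_le Bpp'.
have cA := ht_continuous (a := A); have cB := ht_continuous (a := B).
have [s1 e1] : -1 <= s /\ e <= 1 by split; lra.
have [s'1 e'1] : -1 <= s' /\ e' <= 1 by split; lra.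
have [se [s'e' [s_lt1 s'_lt1]]] : -1 < e /\ -1 < e' /\ s < 1 /\ s' < 1.
  by do !split; lra.
have [t01 u01] : -1 < t0 < 1 /\ -1 < u0 < 1.
  by split; apply/andP; split; lra.
have below (C D : axis R X) q t m : ht D q = 1 -> t < ht C q -> m < 1 ->
    exists l, [/\ m < l, l < 1 & forall x, ht C x <= t -> ht D x < l].
  move=> Dq tq; apply: compact_below_level (ht_continuous (a := D)) _ _ => //.
    exact/continuous_le_closed/ht_continuous.
  move=> x /= xt; have /andP[_] := ht_bound D x.
  rewrite le_eqVlt => /orP[/eqP x1|//].
  by move: tq; rewrite -(ht_top_inj x1 Dq) ltNge xt.
have above (C D : axis R X) q t m : ht D q = -1 -> ht C q < t -> -1 < m ->
    exists l, [/\ -1 < l, l < m & forall x, ht D x <= l -> ht C x < t].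
  move=> Dq qt mM.
  have [||l [l1 lm lP]] := compact_above_level (C := [set x | t <= ht C x]) cX
      (ht_continuous (a := D)) _ _ mM.
  - exact/continuous_ge_closed/ht_continuous.
  - move=> x /= tx; have /andP[+ _] := ht_bound D x.
    rewrite le_eqVlt => /orP[/eqP x1|//].
    by move: qt; rewrite -(ht_bot_inj (esym x1) Dq) ltNge tx.
  - exists l; split=> // x xl; rewrite ltNge; apply/negP => /lP.
    by rewrite ltNge xl.
have [hi [shi hi1 hiP]] := below A B r' e s' Br' er' s'_lt1.
have [hi' [shi' hi'1 hi'P]] := below B A p e' s Ap ep s_lt1.
have hi_min : -1 < Num.min hi e' by rewrite lt_min s'e' andbT; lra.
have hi'_min : -1 < Num.min hi' e by rewrite lt_min se andbT; lra.
have [lo [lo1 + loP]] := above A B r s _ Br rs hi_min.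
have [lo' [lo'1 + lo'P]] := above B A p' s' _ Ap' ps' hi'_min.
rewrite !lt_min => /andP[lo'hi' lo'e] /andP[lohi loe'].
move: t01 u01 => /andP[t0m t01] /andP[u0m u01].
have lo_lt1 := lt_trans lohi hi1; have lo'_lt1 := lt_trans lo'hi' hi'1.
have hi_gt := lt_trans lo1 lohi; have hi'_gt := lt_trans lo'1 lo'hi'.
apply: (@swindle_levels _ _ A B cX hX s t0 e s' u0 e' lo hi lo' hi') => //.
all: try by apply/and5P; split=> //; apply/andP.
exact: lt_trans ue ep.
Qed.

(** * Coordinates on a suspension *)

Section SuspensionCoordinates.
Variables (R : realType) (Y : topologicalType).
Local Notation Sg := (suspension R Y).
Implicit Types (x : Sg) (y : Y) (t : R).

Lemma clamp_in t : Num.max (-1) (Num.min 1 t) \in `[(-1 : R), 1]%classic.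
Proof.
apply/mem_set; rewrite /= in_itv /= le_max lexx /= ge_max ge_min lexx /= andbT.
by lra.
Qed.

(** Clamping makes [susp_pt] below total in the height, so that its continuity
can be stated on the whole line. *)
Definition clamp t : set_type `[(-1 : R), 1] :=
  exist (fun u => u \in `[(-1 : R), 1]%classic) _ (clamp_in t).

Lemma clamp_id t : -1 <= t <= 1 -> set_val (clamp t) = t.
Proof.
by move=> /andP[t1 t2]; rewrite set_valE /= min_r// max_r.
Qed.

Lemma continuous_clamp : continuous clamp.
Proof.
apply: continuous_comp_initial => t.
apply: (@continuous_max R R (fun _ => -1) (fun t => Num.min 1 t)).
  exact: cvg_cst.
apply: (@continuous_min R R (fun _ => 1) (fun t => t)).
  exact: cvg_cst.
exact: cvg_id.
Qed.

Definition susp_pt (y : Y) (t : R) : Sg := suspension_proj (y, clamp t).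
Definition susp_repr (x : Sg) : cylinder R Y :=
  repr (x : {eq_quot suspension_equiv R Y}).
Definition susp_ht (x : Sg) : R := height (susp_repr x).
(** On the two suspension points the value is that of an arbitrary
representative. *)
Definition susp_base (x : Sg) : Y := (susp_repr x).1.

Lemma height_bound (z : cylinder R Y) : -1 <= height z <= 1.
Proof.
by rewrite /height; have := set_valP z.2; rewrite /= in_itv.
Qed.

Lemma cylinder_eta (z : cylinder R Y) : (z.1, clamp (height z)) = z.
Proof.
case: z => y u /=; congr (_, _); apply: val_inj.
by apply: clamp_id; exact: (height_bound (y, u)).
Qed.

Lemma height_clamp y t : -1 <= t <= 1 -> @height R Y (y, clamp t) = t.
Proof. exact: clamp_id. Qed.

Lemma suspension_projP (z w : cylinder R Y) :
  suspension_proj z = suspension_proj w <-> suspension_rel z w.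
Proof. by split=> [/eqmodP|h]//; apply/eqmodP. Qed.

Lemma suspension_rel_repr (z : cylinder R Y) :
  suspension_rel (susp_repr (suspension_proj z)) z.
Proof.
by apply/suspension_projP; rewrite /susp_repr /suspension_proj reprK.
Qed.

Lemma susp_ht_proj (z : cylinder R Y) : susp_ht (suspension_proj z) = height z.
Proof.
rewrite /susp_ht; have /or3P[/eqP->//|/andP[/eqP-> /eqP->]//|] :=
  suspension_rel_repr z.
by move=> /andP[/eqP-> /eqP->].
Qed.

Lemma susp_ptK x : susp_pt (susp_base x) (susp_ht x) = x.
Proof.
by rewrite /susp_pt cylinder_eta /susp_repr /suspension_proj reprK.
Qed.

Lemma susp_ht_bound x : -1 <= susp_ht x <= 1.
Proof. exact: height_bound. Qed.

Lemma susp_ht_pt y t : -1 <= t <= 1 -> susp_ht (susp_pt y t) = t.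
Proof. by move=> t1; rewrite /susp_pt susp_ht_proj height_clamp. Qed.

Lemma susp_base_pt y t : -1 < t < 1 -> susp_base (susp_pt y t) = y.
Proof.
move=> /andP[t1 t2]; have t12 : -1 <= t <= 1 by rewrite !ltW.
have := suspension_rel_repr (y, clamp t).
rewrite /susp_base /suspension_rel height_clamp//.
by rewrite [t == 1]lt_eqF// [t == -1]gt_eqF// !andbF !orbF => /eqP->.
Qed.

Lemma susp_pt_pole t y y' : t = -1 \/ t = 1 -> susp_pt y t = susp_pt y' t.
Proof.
move=> t1; apply/suspension_projP; rewrite /suspension_rel !height_clamp;
  by case: t1 => ->; rewrite ?eqxx ?orbT// ?lexx ?andbT; lra.
Qed.

Lemma susp_bot_inj x x' : susp_ht x = -1 -> susp_ht x' = -1 -> x = x'.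
Proof.
move=> x1 x'1; rewrite -(susp_ptK x) -(susp_ptK x') x1 x'1.
by apply: susp_pt_pole; left.
Qed.

Lemma susp_top_inj x x' : susp_ht x = 1 -> susp_ht x' = 1 -> x = x'.
Proof.
move=> x1 x'1; rewrite -(susp_ptK x) -(susp_ptK x') x1 x'1.
by apply: susp_pt_pole; right.
Qed.

Lemma continuous_from_suspension (Z : topologicalType) (f : Sg -> Z) :
  continuous (fun z : cylinder R Y => f (suspension_proj z)) -> continuous f.
Proof. by move=> cf; apply/quotient_continuous. Qed.

Lemma continuous_suspension_proj : continuous (@suspension_proj R Y).
Proof. exact: pi_continuous. Qed.

Lemma continuous_height : continuous (@height R Y).
Proof.
move=> z; apply: (@continuous_comp _ _ _ snd set_val); first exact: cvg_snd.
exact: initial_continuous.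
Qed.

Lemma continuous_susp_ht : continuous susp_ht.
Proof.
apply: continuous_from_suspension.
have -> : (fun z => susp_ht (suspension_proj z)) = @height R Y.
  by apply/funext => z; exact: susp_ht_proj.
exact: continuous_height.
Qed.

Lemma continuous_susp_pt (T : topologicalType) (f : T -> Y) (g : T -> R) :
  continuous f -> continuous g -> continuous (fun z => susp_pt (f z) (g z)).
Proof.
move=> cf cg z.
have cgz : {for z, continuous (fun z => clamp (g z))}.
  apply: (@continuous_comp _ _ _ g clamp); first exact: cg.
  exact: continuous_clamp.
have cfg : {for z, continuous (fun z => (f z, clamp (g z)))}.
  exact: cvg_pair (cf z) cgz.
apply: (@continuous_comp T (cylinder R Y) Sg (fun z => (f z, clamp (g z)))
  (@suspension_proj R Y)); first exact: cfg.
exact: continuous_suspension_proj.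
Qed.

(** The map that reparametrizes the ray over [y] by [F y]; it is used only for
[F y] that fix [-1] and [1], so that the arbitrary value of [susp_base] at the
suspension points does not matter. *)
Definition fiberwise (F : Y -> R -> R) x : Sg :=
  susp_pt (susp_base x) (F (susp_base x) (susp_ht x)).

Lemma fiberwise_pt (F : Y -> R -> R) y t :
  (forall y, F y (-1) = -1) -> (forall y, F y 1 = 1) -> -1 <= t <= 1 ->
  fiberwise F (susp_pt y t) = susp_pt y (F y t).
Proof.
move=> Fm1 F1 t12; rewrite /fiberwise susp_ht_pt//.
have [-> | tm1] := eqVneq t (-1).
  by rewrite !Fm1; apply: susp_pt_pole; left.
have [-> | t1] := eqVneq t 1; first by rewrite !F1; apply: susp_pt_pole; right.
by rewrite susp_base_pt// !lt_neqAle t1 [-1 == t]eq_sym tm1.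
Qed.

Lemma homeomorphism_fiberwise (d : Y -> R) s c e :
  compact [set: Sg] -> hausdorff_space Sg -> continuous d ->
  -1 <= s -> s < c -> c < e -> e <= 1 -> (forall y, s < d y < e) ->
  homeomorphism (fiberwise (fun y => pl_move s c (d y) e)).
Proof.
move=> cS hS cd s1 sc ce e1 dse.
pose K y := pl_move s c (d y) e; pose K' y := pl_move s (d y) c e.
have sd y : s < d y by case/andP: (dse y).
have de y : d y < e by case/andP: (dse y).
have Km1 y : K y (-1) = -1 by exact: pl_move_low.
have K1 y : K y 1 = 1 by exact: pl_move_high.
have K'm1 y : K' y (-1) = -1 by exact: pl_move_low.
have K'1 y : K' y 1 = 1 by exact: pl_move_high.
have Kht y t : -1 <= t <= 1 -> -1 <= K y t <= 1.
  by move=> /andP[t1 t2]; rewrite -{1}(Km1 y) -{2}(K1 y) /K !pl_move_leE ?t1.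
have K'ht y t : -1 <= t <= 1 -> -1 <= K' y t <= 1.
  by move=> /andP[t1 t2]; rewrite -{1}(K'm1 y) -{2}(K'1 y) /K' !pl_move_leE ?t1.
have KK' : cancel (fiberwise K) (fiberwise K').
  move=> x; rewrite -{1}(susp_ptK x) !fiberwise_pt ?Kht ?susp_ht_bound//.
  by rewrite /K' /K pl_move_inv// susp_ptK.
have K'K : cancel (fiberwise K') (fiberwise K).
  move=> x; rewrite -{1}(susp_ptK x) !fiberwise_pt ?K'ht ?susp_ht_bound//.
  by rewrite /K' /K pl_move_inv// susp_ptK.
apply: compact_hausdorff_homeomorphism => //.
- apply: continuous_from_suspension.
  have -> : (fun z : cylinder R Y => fiberwise K (suspension_proj z)) =
      fun z => susp_pt z.1 (pl_move s c (d z.1) e (height z)).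
    apply/funext => z.
    rewrite -{1}(cylinder_eta z) -/(susp_pt _ _) fiberwise_pt//.
    exact: height_bound.
  apply: continuous_susp_pt; first by move=> z; exact: cvg_fst.
  apply: continuous_pl_move => //; last exact: continuous_height.
  move=> z; apply: (@continuous_comp _ _ _ fst d); last exact: cd.
  exact: cvg_fst.
- exact: can_inj KK'.
- by move=> x; exists (fiberwise K' x).
Qed.

Lemma susp_pt_susp_pt x t u :
  -1 < t < 1 ->
  susp_pt (susp_base (susp_pt (susp_base x) t)) u = susp_pt (susp_base x) u.
Proof. by move=> t1; rewrite susp_base_pt. Qed.

Definition suspension_axis (cS : compact [set: Sg]) (hS : hausdorff_space Sg) :
  axis R Sg.
Proof.
refine (@Axis R Sg susp_ht (fun x => susp_pt (susp_base x)) _ _ _ _ _ _ _ _).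
- exact: continuous_susp_ht.
- exact: susp_ht_bound.
- exact: susp_bot_inj.
- exact: susp_top_inj.
- by move=> x t; exact: susp_ht_pt.
- exact: susp_ptK.
- exact: susp_pt_susp_pt.
- move=> s c d e s1 sc ce sd de e1.
  apply: (@homeomorphism_fiberwise (fun _ => d)) => //.
    by move=> y; exact: cvg_cst.
  by move=> _; rewrite sd.
Defined.

End SuspensionCoordinates.
(** * Antipodal points of a homogeneous suspension *)

(** The height takes its minimum at the bottom only, so a continuous function
separates the bottom, hence by homogeneity every point, from the others. *)
Lemma homogeneous_suspension_hausdorff (R : realType) (Y : topologicalType) :
  homogeneous (suspension R Y) -> hausdorff_space (suspension R Y).
Proof.
have N12 : -1 <= (-1 : R) <= 1 by apply/andP; split; lra.
move=> hom x y xy; apply: contrapT => xney.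
have [g [hg gx]] := hom x (susp_pt (susp_base x) (-1)).
have gx1 : susp_ht (g x) = -1 by rewrite gx susp_ht_pt.
have gxy : susp_ht (g x) <> susp_ht (g y).
  move=> e; apply: xney; apply: (homeomorphism_inj hg).
  by apply: susp_bot_inj; rewrite -?e.
apply: gxy; apply: (@Rhausdorff R) => U V xU yV.
have cf : continuous (fun z => susp_ht (g z)).
  move=> z; apply: (@continuous_comp _ _ _ g (@susp_ht R Y)).
    by case: hg => cg _; exact: cg.
  exact: continuous_susp_ht.
have [z [Uz Vz]] := xy _ _ (cf _ _ xU) (cf _ _ yV).
by exists (susp_ht (g z)).
Qed.

Section Homogeneous.
Variables (R : realType) (Y : topologicalType).
Local Notation Sg := (suspension R Y).
Local Notation ht := (@susp_ht R Y).
Local Notation base := (@susp_base R Y).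
Local Notation pt := (@susp_pt R Y).
Hypotheses (hom : homogeneous Sg) (cS : compact [set: Sg]).
Implicit Types p q r x : Sg.

Let hS : hausdorff_space Sg := homogeneous_suspension_hausdorff hom.
Let A := suspension_axis cS hS.

Definition antipodal q p := exists g : Sg -> Sg,
  [/\ homeomorphism g, ht (g q) = -1 & ht (g p) = 1].

Definition interior_pt x := -1 < ht x < 1.

Lemma interiorP x : [\/ ht x = -1, ht x = 1 | interior_pt x].
Proof.
rewrite /interior_pt; have /andP[] := susp_ht_bound x; rewrite !le_eqVlt.
case: eqP => [->|_ /= x1]; first by constructor 1.
by case: eqP => [->|_ /= x2]; [constructor 2|constructor 3; rewrite x1].
Qed.

Lemma ht_pt_mid (y : Y) (t : R) : -1 < t < 1 -> ht (pt y t) = t.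
Proof. by move=> /andP[t1 t2]; rewrite susp_ht_pt// !ltW. Qed.

Lemma ht_pt_bot (y : Y) : ht (pt y (-1)) = -1.
Proof. by rewrite susp_ht_pt//; apply/andP; split; lra. Qed.

Lemma ht_pt_top (y : Y) : ht (pt y 1) = 1.
Proof. by rewrite susp_ht_pt//; apply/andP; split; lra. Qed.

Lemma susp_eq x y : base x = base y -> ht x = ht y -> x = y.
Proof. by move=> bxy hxy; rewrite -(susp_ptK x) -(susp_ptK y) bxy hxy. Qed.

Lemma antipodal_neq q p : antipodal q p -> q <> p.
Proof. by move=> [g [_ gq gp]] e; move: gp; rewrite -e gq; lra. Qed.

Lemma antipodal_equivariant k q p : homeomorphism k -> antipodal q p ->
  antipodal (k q) (k p).
Proof.
move=> hk [g [hg gq gp]]; have [ki [hki kK _]] := homeomorphism_inv hk.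
by exists (g \o ki); split; rewrite /= ?kK//; exact: homeomorphism_comp hki hg.
Qed.

Lemma chart_bot q : exists g, homeomorphism g /\ ht (g q) = -1.
Proof.
have [g [hg gq]] := hom q (pt (base q) (-1)).
by exists g; rewrite gq ht_pt_bot.
Qed.

Lemma chart_top q : exists g, homeomorphism g /\ ht (g q) = 1.
Proof.
have [g [hg gq]] := hom q (pt (base q) 1).
by exists g; rewrite gq ht_pt_top.
Qed.

Lemma antipodal_poles n s : ht n = -1 -> ht s = 1 -> antipodal n s.
Proof. by exists id; split=> //; exact: homeomorphism_id. Qed.

Lemma antipodal_ex q : exists q', antipodal q q'.
Proof.
have [g [hg gq]] := chart_bot q; have [gi [_ _ giK]] := homeomorphism_inv hg.
by exists (gi (pt (base q) 1)); exists g; split; rewrite // giK ht_pt_top.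
Qed.

Definition flip x := pt (base x) (- ht x).

Lemma ht_flip x : ht (flip x) = - ht x.
Proof. by rewrite susp_ht_pt//; have := susp_ht_bound x; lra. Qed.

Lemma base_flip x : interior_pt x -> base (flip x) = base x.
Proof. by rewrite /interior_pt => x1; rewrite susp_base_pt//; lra. Qed.

Lemma flipK : involutive flip.
Proof.
move=> x; have [x1|x1|x1] := interiorP x.
- by apply: susp_bot_inj; rewrite ?ht_flip ?x1 ?opprK.
- by apply: susp_top_inj; rewrite ?ht_flip ?x1 ?opprK.
- have fx : interior_pt (flip x) by move: x1; rewrite /interior_pt ht_flip; lra.
  by apply: susp_eq; rewrite ?base_flip// !ht_flip opprK.
Qed.

Lemma homeomorphism_flip : homeomorphism flip.
Proof.
suff cf : continuous flip by split=> //; exists flip; split=> //; exact: flipK.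
apply: continuous_from_suspension.
have -> : (fun z : cylinder R Y => flip (suspension_proj z)) =
    fun z => pt z.1 (- height z).
  apply/funext => z; rewrite -{1}(cylinder_eta z) -/(susp_pt _ _).
  have zb := height_bound z; have [z1|z1] := EM (-1 < height z < 1).
    by rewrite /flip susp_base_pt// ht_pt_mid.
  rewrite /flip susp_ht_pt//; apply: susp_pt_pole.
  have [->|h1] := eqVneq (height z) (-1); first by rewrite opprK; right.
  have [->|h2] := eqVneq (height z) 1; first by left.
  by case: z1; rewrite !lt_neqAle eq_sym h1 h2.
apply: continuous_susp_pt; first by move=> z; exact: cvg_fst.
move=> z; apply: (@continuousN _ _ _ (@height R Y)).
exact: continuous_height.
Qed.

Lemma antipodal_sym q p : antipodal q p -> antipodal p q.
Proof.
move=> [g [hg gq gp]]; exists (flip \o g); split.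
- exact: homeomorphism_comp hg homeomorphism_flip.
- by rewrite /= ht_flip gp.
- by rewrite /= ht_flip gq opprK.
Qed.

Lemma pole_slide s c d e x : admissible s c d e -> ht x = -1 \/ ht x = 1 ->
  slide A s c d e x = x.
Proof.
move=> adm x1; apply: slide_fix => //.
move: adm => /and5P[s1 _ _ _ /andP[_ e1]].
case: x1 => [x1|x1]; [left|right].
  by change (ht x <= s); rewrite x1.
by change (e <= ht x); rewrite x1.
Qed.

(** The hypotheses say that two charts, that is homeomorphisms from the
suspension to itself, place the poles of each other as the swindle requires. *)
Lemma antipodal_swindle g1 g2 p' p r r' :
  homeomorphism g1 -> homeomorphism g2 ->
  ht (g1 p') = -1 -> ht (g1 p) = 1 -> ht (g2 r) = -1 -> ht (g2 r') = 1 ->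
  ht (g1 r) < ht (g1 r') -> ht (g2 p') < ht (g2 p) -> antipodal r p.
Proof.
move=> h1 h2 g1p' g1p g2r g2r' g1rr' g2pp'.
have [A1 A1E] := pullback_axis A h1; have [A2 A2E] := pullback_axis A h2.
have [|||||| th [hth thr thr']] := @swindle R Sg A1 A2 p' p r r' cS hS;
  rewrite ?A1E ?A2E//.
rewrite -thr -thr'; apply: antipodal_equivariant => //.
by exists g2.
Qed.

(** The height in a chart that carries [pt a 0] to the bottom is minimal at that
point only; this replaces an appeal to Urysohn's lemma on [Y]. *)
Lemma base_separation (a b : Y) : a <> b -> exists f : Y -> R,
  [/\ continuous f, f a = 0, f b = 1 & forall y, 0 <= f y <= 1].
Proof.
move=> ab; have i0 : -1 < (0 : R) < 1 by lra.
have [g [hg ga]] := chart_bot (pt a 0).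
pose f0 y := ht (g (pt y 0)) + 1.
have f0_ge y : 0 <= f0 y.
  by have := susp_ht_bound (g (pt y 0)); rewrite /f0; lra.
have f0b : 0 < f0 b.
  rewrite lt_neqAle f0_ge andbT; apply/eqP => e; apply: ab.
  rewrite -(susp_base_pt a i0) -(susp_base_pt b i0); congr base.
  apply: (homeomorphism_inj hg); apply: susp_bot_inj => //.
  by move: e; rewrite /f0; lra.
have cf0 : continuous f0.
  have c1 : continuous (fun y => pt y 0).
    by apply: continuous_susp_pt => y; [exact: cvg_id|exact: cvg_cst].
  have [cg _] := hg.
  have c2 : continuous (fun y => ht (g (pt y 0))).
    move=> y; apply: (continuous_comp (f := fun y => g (pt y 0)) (g := ht)).
      apply: (continuous_comp (f := fun y => pt y 0) (g := g)).
        exact: c1.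
      exact: cg.
    exact: continuous_susp_ht.
  by move=> y; apply: (@continuousD R R^o Y); [exact: c2|exact: cvg_cst].
exists (fun y => Num.min 1 (f0 y / f0 b)); split.
- move=> y; apply: (@continuous_min R Y (fun _ => 1) (fun y => f0 y / f0 b)).
    exact: cvg_cst.
  by apply: continuousM; [exact: cf0|exact: cvg_cst].
- have -> : f0 a = 0 by rewrite /f0 ga; lra.
  by rewrite mul0r min_r.
- by rewrite divff ?gt_eqF// minxx.
- move=> y; rewrite ge_min lexx le_min ler01 /= andbT.
  by rewrite divr_ge0.
Qed.

(** The slide of the ray over [y] is chosen to depend continuously on [y], and
to be trivial over the base of [z']. *)
Lemma move_along_ray z z' l : interior_pt z -> base z <> base z' ->
  -1 < l < 1 -> exists k : Sg -> Sg,
  [/\ homeomorphism k, forall x, ht x = -1 \/ ht x = 1 -> k x = x,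
      k z' = z' & ht (k z) = l].
Proof.
move=> /andP[z1 z2] zz' /andP[l1 l2].
have [f [cf fz fz' f01]] := base_separation zz'.
pose d y := l + f y * (ht z - l).
have dse y : -1 < d y < 1.
  have /andP[f0 f1] := f01 y.
  have [f_le|f_gt] := leP (f y) (1 / 2).
    have a1 : 0 < (1 - f y) * (l + 1) by rewrite mulr_gt0//; lra.
    have a2 : 0 < (1 - f y) * (1 - l) by rewrite mulr_gt0//; lra.
    have a3 : 0 <= f y * (ht z + 1) by rewrite mulr_ge0//; lra.
    have a4 : 0 <= f y * (1 - ht z) by rewrite mulr_ge0//; lra.
    by rewrite /d; lra.
  have a1 : 0 <= (1 - f y) * (l + 1) by rewrite mulr_ge0//; lra.
  have a2 : 0 <= (1 - f y) * (1 - l) by rewrite mulr_ge0//; lra.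
  have a3 : 0 < f y * (ht z + 1) by rewrite mulr_gt0//; lra.
  have a4 : 0 < f y * (1 - ht z) by rewrite mulr_gt0//; lra.
  by rewrite /d; lra.
have cd : continuous d.
  move=> y; apply: (@continuousD R R^o Y); first exact: cvg_cst.
  by apply: continuousM; [exact: cf|exact: cvg_cst].
exists (fiberwise (fun y => pl_move (-1) (ht z) (d y) 1)); split.
- by apply: homeomorphism_fiberwise.
- move=> x x1; have /andP[d1 d2] := dse (base x).
  rewrite /fiberwise.
  have -> : pl_move (-1) (ht z) (d (base x)) 1 (ht x) = ht x.
    by case: x1 => ->; [exact: pl_move_low|exact: pl_move_high].
  exact: susp_ptK.
- rewrite /fiberwise; have -> : d (base z') = ht z by rewrite /d fz'; ring.
  by rewrite pl_move_refl// susp_ptK.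
- rewrite /fiberwise; have -> : d (base z) = l by rewrite /d fz; ring.
  by rewrite pl_move_node// ht_pt_mid// l1.
Qed.

(** By homogeneity it is enough to find one such point.  If [z'] is antipodal to
[z], a homeomorphism that fixes [z'] and moves [z] gives [z'] two antipodal
points. *)
Lemma antipodal_two q : exists x y, [/\ antipodal q x, antipodal q y & x <> y].
Proof.
suff [z0 [x [y [zx zy xy]]]] :
    exists z0 x y, [/\ antipodal z0 x, antipodal z0 y & x <> y].
  have [k [hk <-]] := hom z0 q; exists (k x), (k y).
  by split; try exact: antipodal_equivariant; move/(homeomorphism_inj hk).
have i0 : -1 < (0 : R) < 1 by lra.
set z := pt (base q) 0; have z0 : ht z = 0 by rewrite ht_pt_mid.
have zi : interior_pt z by rewrite /interior_pt z0.
have [z' zz'] := antipodal_ex z.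
have z'z := antipodal_sym zz'.
have moved k d : homeomorphism k -> k z' = z' -> ht (k z) = d -> d <> 0 ->
    exists z0 x y, [/\ antipodal z0 x, antipodal z0 y & x <> y].
  move=> hk kz' kz d0; exists z', z, (k z); split=> //.
    by rewrite -kz'; exact: antipodal_equivariant.
  by move=> e; move: kz; rewrite -e z0 => /esym.
have [z'1|z'1|z'i] := interiorP z'.
- exists z', z, (pt (base q) 1); split=> //.
    by apply: antipodal_poles; rewrite ?ht_pt_top.
  by move=> /(congr1 ht); rewrite z0 ht_pt_top; lra.
- exists z', z, (pt (base q) (-1)); split=> //.
    by apply/antipodal_sym/antipodal_poles; rewrite ?ht_pt_bot.
  by move=> /(congr1 ht); rewrite z0 ht_pt_bot; lra.
have /andP[z'1 z'2] := z'i.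
have [bzz'|bzz'] := EM (base z = base z'); last first.
  have i2 : -1 < (1 / 2 : R) < 1 by lra.
  have [k [hk _ kz' kz]] := move_along_ray zi bzz' i2.
  by apply: (moved k (1 / 2)) => //; lra.
have z'0 : ht z' <> 0.
  by move=> e; apply: (antipodal_neq zz'); apply: susp_eq => //; rewrite z0 e.
have [z'neg|z'pos|//] := ltgtP (ht z') 0.
  have adm : admissible (ht z') 0 (1 / 2) 1.
    by apply/and5P; split; try lra; apply/andP; split; lra.
  apply: (moved (slide A (ht z') 0 (1 / 2) 1) (1 / 2)); last lra.
  - exact: homeomorphism_slide.
  - by apply: slide_fix => //; left.
  - by rewrite slide_node// [LHS]ht_pt_mid//; lra.
have adm : admissible (-1) 0 (ht z' / 2) (ht z').
  by apply/and5P; split; try lra; apply/andP; split; lra.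
apply: (moved (slide A (-1) 0 (ht z' / 2) (ht z')) (ht z' / 2)); last lra.
- exact: homeomorphism_slide.
- by apply: slide_fix => //; right.
- by rewrite slide_node// [LHS]ht_pt_mid//; lra.
Qed.

(** In the structure from [q] to [x], sliding [y] along its ray shows that the
whole open ray of [y] is antipodal to [q], so it lies on the ray of [q] in the
original structure.  The height is thus continuous and injective, hence
monotone, along this path from [q] through [y] to [x]. *)
Lemma antipodal_between q x y :
  (forall r, antipodal q r -> interior_pt r /\ base r = base q) ->
  interior_pt q -> antipodal q x -> antipodal q y -> x <> y ->
  ht q < ht y < ht x \/ ht x < ht y < ht q.
Proof.
move=> ray qi qx qy xy.
have [g [hg gq gx]] := qx; have [gi [hgi gK giK]] := homeomorphism_inv hg.
have gyi : interior_pt (g y).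
  have [y1|y1|//] := interiorP (g y); exfalso.
    by apply: (antipodal_neq qy); apply: (homeomorphism_inj hg);
      apply: susp_bot_inj.
  by apply: xy; apply: (homeomorphism_inj hg); apply: susp_top_inj.
pose u := ht (g y); have /andP[u1 u2] := gyi.
pose M t := gi (pt (base (g y)) t).
have M1 : M (-1) = q.
  by rewrite /M -[RHS]gK; congr gi; apply: susp_bot_inj; rewrite ?ht_pt_bot.
have M2 : M 1 = x.
  by rewrite /M -[RHS]gK; congr gi; apply: susp_top_inj; rewrite ?ht_pt_top.
have Mu : M u = y by rewrite /M susp_ptK gK.
have qM t : -1 < t < 1 -> antipodal q (M t).
  move=> /andP[t1 t2].
  have adm : admissible (-1) u t 1 by apply/and5P; split => //; apply/andP.
  pose k := gi \o slide A (-1) u t 1 \o g.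
  have kE r : k r = gi (slide A (-1) u t 1 (g r)) by [].
  have -> : q = k q by rewrite kE pole_slide ?gK//; left.
  have -> : M t = k y by rewrite kE slide_node.
  apply: antipodal_equivariant => //.
  apply: homeomorphism_comp hgi.
  exact: homeomorphism_comp hg (homeomorphism_slide A adm).
have Mray t : -1 <= t <= 1 -> base (M t) = base q.
  move=> /andP[t1 t2]; have [->|tm1] := eqVneq t (-1); first by rewrite M1.
  have [->|t11] := eqVneq t 1; first by rewrite M2; have [] := ray _ qx.
  by have [|//] := ray _ (qM t _); rewrite !lt_neqAle eq_sym tm1 t11 t1.
have minj : {in `[-1, 1] &, injective (ht \o M)}.
  move=> t v; rewrite !in_itv/= => t1 v1 e.
  have /(homeomorphism_inj hgi)/(congr1 ht) : M t = M v.
    by apply: susp_eq => //; rewrite !Mray.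
  by rewrite !susp_ht_pt.
have cm : continuous (ht \o M).
  have c1 : continuous (fun t => pt (base (g y)) t).
    by apply: continuous_susp_pt => t; [exact: cvg_cst|exact: cvg_id].
  have [cgi _] := hgi.
  move=> t; apply: (continuous_comp (f := M) (g := ht)).
    apply: (continuous_comp (f := fun t => pt (base (g y)) t) (g := gi)).
      exact: c1.
    exact: cgi.
  exact: continuous_susp_ht.
have := itv_continuous_inj_mono (continuous_subspaceT cm) minj.
have i1 : (-1 : R) \in `[-1, 1] by rewrite in_itv/=; apply/andP; split; lra.
have i2 : (1 : R) \in `[-1, 1] by rewrite in_itv/=; apply/andP; split; lra.
have i3 : u \in `[-1, 1] by rewrite in_itv/= !ltW.
move=> [mono|mono]; [left|right].
  by rewrite -M1 -M2 -Mu; rewrite !mono// u1.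
by rewrite -M1 -M2 -Mu; rewrite !mono// u1 u2.
Qed.

Lemma antipodal_off_ray q : interior_pt q ->
  exists q', antipodal q q' /\ ~ (interior_pt q' /\ base q' = base q).
Proof.
move=> qi; apply: contrapT => noq'.
have ray r : antipodal q r -> interior_pt r /\ base r = base q.
  by move=> qr; apply: contrapT => nr; apply: noq'; exists r.
have [x [y [qx qy xy]]] := antipodal_two q.
have yx : y <> x by move=> e; apply: xy.
have := antipodal_between ray qi qx qy xy.
have := antipodal_between ray qi qy qx yx.
by lra.
Qed.

(** A flip exchanges the suspension points, and sliding afterwards along the ray
of [q] brings [q] back to its place. *)
Lemma antipodal_bot_top q n s : interior_pt q -> ht n = -1 -> ht s = 1 ->
  antipodal q n -> antipodal q s.
Proof.
move=> qi n1 s1 qn; have /andP[q1 q2] := qi.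
have adm : admissible (-1) (- ht q) (ht q) 1.
  by apply/and5P; split; try lra; apply/andP; split; lra.
pose k := slide A (-1) (- ht q) (ht q) 1 \o flip.
have -> : s = k n.
  have kE r : k r = slide A (-1) (- ht q) (ht q) 1 (flip r) by [].
  have fn1 : ht (flip n) = 1 by rewrite ht_flip n1 opprK.
  by apply: susp_top_inj => //; rewrite kE pole_slide//; right.
have -> : q = k q.
  have kE r : k r = slide A (-1) (- ht q) (ht q) 1 (flip r) by [].
  rewrite kE slide_node; [|exact: adm|exact: ht_flip].
  by rewrite -[RHS]/(pt (base (flip q)) (ht q)) base_flip// susp_ptK.
apply: antipodal_equivariant qn.
exact: homeomorphism_comp homeomorphism_flip (homeomorphism_slide A adm).
Qed.

(** Once [q] is slid below [q'], each of the two structures, the standard one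
and the one from [q] to [q'], has a ball as the swindle requires. *)
Lemma antipodal_top_of_chart g q q' n s : homeomorphism g ->
  ht n = -1 -> ht s = 1 -> interior_pt q -> interior_pt q' ->
  base q <> base q' -> ht (g q) = -1 -> ht (g q') = 1 ->
  ht (g n) < ht (g s) -> antipodal q s.
Proof.
move=> hg n1 s1 qi /andP[q'1 q'2] qq' gq gq' gns.
have i2 : -1 < (ht q' - 1) / 2 < 1 by lra.
have [k [hk kpole kq' kq]] := move_along_ray qi qq' i2.
apply: (antipodal_swindle (g1 := k) (g2 := g) (p' := n) (r' := q')) => //.
- by rewrite kpole//; left.
- by rewrite kpole//; right.
- by rewrite kq kq'; lra.
Qed.

(** If the chart [g] from [q] to [q'] puts the bottom above the top, flipping
the suspension first exchanges their roles; if it puts them at the same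
height, they are on different rays of [g] and one of them can be moved down. *)
Lemma antipodal_top q s : ht s = 1 -> q <> s -> antipodal q s.
Proof.
move=> s1 qs; set n := pt (base q) (-1).
have n1 : ht n = -1 by exact: ht_pt_bot.
have [q1|q1|qi] := interiorP q.
- exact: antipodal_poles.
- by case: qs; exact: susp_top_inj.
have [q' [qq' q'off]] := antipodal_off_ray qi.
have [q'1|q'1|q'i] := interiorP q'.
- exact: antipodal_bot_top qi q'1 s1 qq'.
- by have <- : q' = s by exact: susp_top_inj.
have bqq' : base q <> base q' by move=> e; apply: q'off.
have [g [hg gq gq']] := qq'.
have neq_ht x y : ht x <> ht y -> x <> y by move=> h e; apply: h; rewrite e.
have [gns|gsn|gns] := ltgtP (ht (g n)) (ht (g s)).
- exact: (antipodal_top_of_chart hg n1 s1 qi q'i bqq' gq gq' gns).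
- have fi x : interior_pt x -> interior_pt (flip x).
    by rewrite /interior_pt ht_flip; lra.
  have fn : flip n = s by apply: susp_top_inj; rewrite ?ht_flip// n1 opprK.
  have fs : flip s = n by rewrite -fn flipK.
  have := @antipodal_top_of_chart (g \o flip) (flip q) (flip q') n s.
  rewrite /= !flipK fn fs !base_flip//.
  move=> /(_ _ n1 s1 (fi _ qi) (fi _ q'i) bqq' gq gq' gsn).
  move=> /(_ (homeomorphism_comp homeomorphism_flip hg)).
  move=> /(antipodal_equivariant homeomorphism_flip); rewrite flipK fs.
  exact: antipodal_bot_top.
- have ns : n <> s by apply: neq_ht; rewrite n1 s1; lra.
  have nonpole x : ht x = -1 \/ ht x = 1 -> interior_pt (g x).
    move=> x1; have [gx|gx|//] := interiorP (g x); exfalso.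
      have xq : x = q by apply: (homeomorphism_inj hg); exact: susp_bot_inj.
      by move: x1 qi; rewrite /interior_pt xq; lra.
    have xq : x = q' by apply: (homeomorphism_inj hg); exact: susp_top_inj.
    by move: x1 q'i; rewrite /interior_pt xq; lra.
  have gni := nonpole _ (or_introl n1); have gsi := nonpole _ (or_intror s1).
  have bns : base (g n) <> base (g s).
    by move=> e; apply: ns; apply: (homeomorphism_inj hg); exact: susp_eq.
  have /andP[gs1 gs2] := gsi.
  have i2 : -1 < (ht (g s) - 1) / 2 < 1 by lra.
  have [k [hk kpole kgs kgn]] := move_along_ray gni bns i2.
  apply: (antipodal_top_of_chart (homeomorphism_comp hg hk) n1 s1 qi q'i bqq').
  - by rewrite /= kpole//; left.
  - by rewrite /= kpole//; right.
  - by rewrite /= kgs kgn; lra.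
Qed.

Lemma antipodal_all q p : q <> p -> antipodal q p.
Proof.
move=> qp; have [g [hg gp]] := chart_top p.
have [gi [hgi gK _]] := homeomorphism_inv hg.
rewrite -(gK q) -(gK p); apply: antipodal_equivariant => //.
by apply: antipodal_top => // /(homeomorphism_inj hg).
Qed.

End Homogeneous.

Theorem corollary1 (R : realType) (X : topologicalType)
    (X_homogeneous : homogeneous X)
    (X_compact : compact [set: X])
    (X_suspension : is_suspension R X) :
  absolute_suspension R X.
Proof.
split=> // p q pq.
have [Y [f hf]] := X_suspension; have [fi [hfi fK fiK]] := homeomorphism_inv hf.
have hom : homogeneous (suspension R Y).
  move=> x y; have [h [hh hxy]] := X_homogeneous (fi x) (fi y).
  exists (f \o h \o fi); split; last by rewrite /= hxy fiK.
  exact: homeomorphism_comp (homeomorphism_comp hfi hh) hf.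
have cS : compact [set: suspension R Y].
  have -> : [set: suspension R Y] = f @` [set: X].
    by apply/seteqP; split=> // y _; exists (fi y).
  by apply: continuous_compact => //; apply: continuous_subspaceT; case: hf.
have fpq : f p <> f q by move/(homeomorphism_inj hf).
have [g [hg gp gq]] := antipodal_all hom cS fpq.
exists Y, (g \o f); split; first exact: homeomorphism_comp hf hg.
have [gi [_ _ giK]] := homeomorphism_inv hg.
apply/seteqP; split=> [_ [x [->|->] <-]|_ [z z1 <-]].
- exists (susp_repr (g (f p))); last by rewrite /= /suspension_proj reprK.
  by left.
- exists (susp_repr (g (f q))); last by rewrite /= /suspension_proj reprK.
  by right.
- case: z1 => z1; [exists p; first by left|exists q; first by right] => /=.
    by apply: susp_bot_inj; rewrite // susp_ht_proj.
  by apply: susp_top_inj; rewrite // susp_ht_proj.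
Qed.
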